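(* Every instance of PMCLP-PCR-QoS has an optimal solution $(\mathbf{x}^*,\mathbf{y}^*,\mathbf{z}^* )=(x^*_{s_1},\ldots,x^*_{s_p},y^*_{s_1},\ldots,y^*_{s_p},z^*_{s_1},\ldots,z^*_{s_p})$, with $(x^*_{s_j},y^*_{s_j},z^*_{s_j})\in\mathbb{R}^2\times\Xi$ for all $j=1,\ldots,p$, such that both of the following conditions are satisfied: (i) There exists a non-repetitive sequence $s_{t_1},s_{t_2},\ldots,s_{t_p}\in\mathcal{S}$ of the service zones such that $x^*_{s_{t_1}}\in X_{ID}$ and, for $k=2,\ldots,p$, $x^*_{s_{t_k}}\in X_{ID}\cup\mathcal{X}_{OS}(\Xi,T_k)$, where $T_k=\{t_1,\ldots,t_{k-1}\}$ and $t_k\in P$. (ii) There exists a non-repetitive sequence $s_{q_1},s_{q_2},\ldots,s_{q_p}\in\mathcal{S}$ of the service zones such that $y^*_{s_{q_1}}\in Y_{ID}$ and, for $k=2,\ldots,p$, $y^*_{s_{q_k}}\in Y_{ID}\cup\mathcal{Y}_{OS}(\Xi,Q_k)$, where $Q_k=\{q_1,\ldots,q_{k-1}\}$ and $q_k\in P$. In other words, $x^*_{s_j}$ is an $x$ IDCV or an $x$ OSCV for all $j\in P$, and $x^*_{s_t}\in X_{ID}$ for at least one service zone $s_t$, $t\in P$; the same is true for $y^*_{s_j}$, $j\in P$.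
   Context: **Problem PMCLP-PCR-QoS.** Let $\mathcal{D}=\{d_1,\ldots,d_n\}$ be a set of $n$ (possibly overlapping) axis-parallel rectangles in the plane, called demand zones (DZs). DZ $d_i$ has known lower left corner $(x_{d_i},y_{d_i})\in\mathbb{R}^2$, width $w_{d_i}$ and length $l_{d_i}$ with $(w_{d_i},l_{d_i})\in\mathbb{R}^2_+$, so it occupies $[x_{d_i},x_{d_i}+w_{d_i}]\times[y_{d_i},y_{d_i}+l_{d_i}]$, and a base reward rate per unit area $v_i\in\mathbb{R}_+$. The base service zone $s_0$ is an axis-parallel rectangle of width $w_{s_0}$ and length $l_{s_0}$. There are $p$ service zones (SZs) $\mathcal{S}=\{s_1,\ldots,s_p\}$; let $P=\{1,\ldots,p\}$. Each $s_j$ has a scaling factor (QoS) $z_{s_j}$ chosen from a common finite set $\Xi=\{\xi_1,\ldots,\xi_m\}$ of numbers $\ge 1$, and a lower left corner $(x_{s_j},y_{s_j})\in\mathbb{R}^2$ chosen freely; it is then the axis-parallel rectangle of width $z_{s_j}w_{s_0}$ and length $z_{s_j}l_{s_0}$ with that lower left corner. The reward rate (per unit area) for covering part of $d_i$ by an SZ with scaling factor $z$ is $v_i^z=v_i/\eta(z)\le v_i$, where $\eta$ is a given strictly increasing function. Partial coverage is allowed. The problem is to maximize $$f(\mathbf{x},\mathbf{y},\mathbf{z})=\sum_{i=1}^n\mathcal{T}_i\Big(d_i\cap\big(\textstyle\bigcup_{j=1}^p s_j\big)\Big),$$ where $\mathcal{T}_i$ returns the total reward captured from $d_i$ by $s_1,\ldots,s_p$.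 A subregion of $d_i$ covered by several SZs is rewarded once, at the rate corresponding to the best QoS (smallest scaling factor) among the SZs covering it. **Inner DZ critical values (IDCVs).** For DZ $d_i$ and $z\in\Xi$, the $x$ IDCVs are $x_{d_i}$ and $x_{d_i}+w_{d_i}-w_{s_0}z$, and the $y$ IDCVs are $y_{d_i}$ and $y_{d_i}+l_{d_i}-l_{s_0}z$. Set $$X_{ID}=\bigcup_{z\in\Xi}\bigcup_{i=1}^n\{x_{d_i},\,x_{d_i}+w_{d_i}-w_{s_0}z\},\qquad Y_{ID}=\bigcup_{z\in\Xi}\bigcup_{i=1}^n\{y_{d_i},\,y_{d_i}+l_{d_i}-l_{s_0}z\}.$$ **Outer SZ critical values (OSCVs).** For a set $\mathcal{J}\subset P$ of indices of positioned SZs (with known lower left corners $(x_{s_j},y_{s_j})$ and scaling factors $z_{s_j}$, $j\in\mathcal{J}$), the sets of $x$ OSCVs and $y$ OSCVs are $$\mathcal{X}_{OS}(\Xi,\mathcal{J})=\bigcup_{z\in\Xi}\bigcup_{j\in\mathcal{J}}\{x_{s_j}-w_{s_0}z,\;x_{s_j}+w_{s_0}z_{s_j}\},\qquad \mathcal{Y}_{OS}(\Xi,\mathcal{J})=\bigcup_{z\in\Xi}\bigcup_{j\in\mathcal{J}}\{y_{s_j}-l_{s_0}z,\;y_{s_j}+l_{s_0}z_{s_j}\}.$$ In the theorem these sets are formed from the positions and scaling factors of the optimal solution, i.e. with $x_{s_j}=x^*_{s_j}$, $y_{s_j}=y^*_{s_j}$, $z_{s_j}=z^*_{s_j}$. 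*)

(* Defs.v *)
From mathcomp Require Import all_boot all_order all_algebra.
From mathcomp Require Import all_classical all_reals all_analysis.
Set Implicit Arguments.
Unset Strict Implicit.
Unset Printing Implicit Defensive.
Import Order.TTheory GRing.Theory Num.Theory.
Local Open Scope classical_set_scope.
Local Open Scope ring_scope.

(* [w0], [l0] are the dimensions of the base service zone.  Positivity of
   [eta] on [Xi] is implicit in [v i / eta z] being a reward rate; rectangles
   of zero width or length are allowed. *)
Record pmclp (R : realType) (n p : nat) := Pmclp {
  xd : 'I_n -> R;
  yd : 'I_n -> R;
  wd : 'I_n -> R;
  ld : 'I_n -> R;
  v : 'I_n -> R;
  w0 : R;
  l0 : R;
  Xi : set R;
  eta : R -> R;
  wd_ge0 : forall i, 0 <= wd i;
  ld_ge0 : forall i, 0 <= ld i;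
  v_ge0 : forall i, 0 <= v i;
  w0_ge0 : 0 <= w0;
  l0_ge0 : 0 <= l0;
  Xi_finite : finite_set Xi;
  Xi_neq0 : Xi !=set0;
  Xi_ge1 : forall z, Xi z -> 1 <= z;
  eta_incr : {in `[1, +oo[ &, {homo eta : a b / a < b}};
  eta_gt0 : forall z, Xi z -> 0 < eta z;
  rate_le : forall i z, Xi z -> v i / eta z <= v i }.

Record solution (R : realType) (p : nat) := Solution {
  xs : 'I_p -> R;
  ys : 'I_p -> R;
  zs : 'I_p -> R }.

Definition rectangle (R : realType) (x y w l : R) : set (R * R) :=
  `[x, x + w] `*` `[y, y + l].

Section Problem.
Context {R : realType} {n p : nat} (I : pmclp R n p).
Implicit Types (s : solution R p) (i : 'I_n) (j : 'I_p).

Definition demand_zone i : set (R * R) :=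
  rectangle (xd I i) (yd I i) (wd I i) (ld I i).

Definition service_zone s j : set (R * R) :=
  rectangle (xs s j) (ys s j) (zs s j * w0 I) (zs s j * l0 I).

Definition feasible s := forall j, Xi I (zs s j).

Definition rate i (z : R) : R := v I i / eta I z.

(* The infimum of a finite set, nonempty as soon as [q] is covered: it is the
   smallest scaling factor among the service zones containing [q]. *)
Definition best_qos s (q : R * R) : R :=
  inf [set zs s j | j in [set j | service_zone s j q]].

Definition captured s i : \bar R :=
  \int[(@lebesgue_measure R \x @lebesgue_measure R)%E]_(q in
      demand_zone i `&` \bigcup_j service_zone s j)
    (rate i (best_qos s q))%:E.

Definition objective s : \bar R := (\sum_(i < n) captured s i)%E.

Definition optimal s :=
  feasible s /\ forall s', feasible s' -> (objective s' <= objective s)%E.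

Definition X_ID : set R :=
  \bigcup_(z in Xi I) \bigcup_i [set xd I i; xd I i + wd I i - w0 I * z].

Definition Y_ID : set R :=
  \bigcup_(z in Xi I) \bigcup_i [set yd I i; yd I i + ld I i - l0 I * z].

Definition X_OS s (J : set 'I_p) : set R :=
  \bigcup_(z in Xi I) \bigcup_(j in J)
    [set xs s j - w0 I * z; xs s j + w0 I * zs s j].

Definition Y_OS s (J : set 'I_p) : set R :=
  \bigcup_(z in Xi I) \bigcup_(j in J)
    [set ys s j - l0 I * z; ys s j + l0 I * zs s j].

End Problem.

(* Indices start at 0, so [t k] is the (k+1)-st term of the sequence and
   [[set t l | l in [set l | (l < k)%N]]] is the set of the terms before it. *)
Definition critical_sequence (R : realType) (p : nat)
    (ID : set R) (OS : set 'I_p -> set R) (c : 'I_p -> R) :=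
  exists t : 'I_p -> 'I_p, injective t /\
    forall k : 'I_p,
      (k = 0%N :> nat -> ID (c (t k))) /\
      ((0 < k)%N ->
        (ID `|` OS [set t l | l in [set l : 'I_p | (l < k)%N]]) (c (t k))).

Definition all_critical (R : realType) (p : nat)
    (ID : set R) (OS : set 'I_p -> set R) (c : 'I_p -> R) :=
  (forall j, (ID `|` OS [set~ j]) (c j)) /\ exists j, ID (c j).

(* Main.v *)
Require Import Defs.
From mathcomp Require Import all_boot all_order all_algebra.
From mathcomp Require Import all_classical all_reals all_analysis.
From mathcomp Require Import measurable_realfun ring lra.

(** Existence of optimal solutions at critical positions.

Fix the scaling factors.  Rates decrease with the scaling factor, so the
reward density at a point of a demand zone is the maximum of the rates of the
service zones covering it; cutting this maximum into layers ([max_layers])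
writes the objective as a combination, with nonnegative coefficients that do
not depend on the positions, of areas of [d_i] covered by unions of service
zones ([objective_reward]).

Now let some service zones stand still at abscissae that already form an
initial part of a critical sequence, and translate all the others together
horizontally by [t].  On a horizontal line, the covered length as a function
of [t] is piecewise affine, and it bends downwards only where two left ends
or two right ends of the following kinds meet.  The fixed part is the demand
zone minus the resting service zones: its left ends are the left end of the
zone or right ends of resting service zones, and symmetrically.  The moving
part is a union of service zones, with left and right ends among theirs.
Hence the downward bends occur exactly when a moving service zone becomes
aligned with a side of a demand zone from inside, or touches a resting service
zone from outside: these are the critical positions.  Between two of them the
objective is convex ([section_convex], [area_convex], [reward_convex]).  Since
moving the group far away yields the least reward, some critical translation
is at least as good as the present position ([event_le]); it puts one more
service zone in the sequence ([anchor_one]), and iterating anchors all of them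
([anchor_all]).  As the area is symmetric in the two coordinates, the
ordinates are treated by the same argument.

Thus each feasible solution is dominated by one with critical abscissae and
ordinates.  There are only finitely many of the latter, since each coordinate
is determined by finitely many choices ([anchored_grid]); the best of them is
optimal ([exists_optimal_anchored]). *)

Set Implicit Arguments.
Unset Strict Implicit.
Unset Printing Implicit Defensive.
Import Order.TTheory GRing.Theory Num.Theory.
Local Open Scope ring_scope.

(** * Layers of a maximum *)

(** The layer-cake formula for a maximum: the weights are the successive
gaps between the values of [r], each carried by the corresponding superlevel
set of [r], and a superlevel set meets [K] exactly when it contains a
maximiser of [r] on [K].  Peeling off the lowest positive value shrinks the
support, whence the induction. *)
Lemma max_layers (R : realFieldType) (T : finType) (r : T -> R) :
  (forall j, 0 <= r j) ->
  exists2 W : {set T} -> R, (forall L, 0 <= W L) &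
    forall (K : pred T) (j : T), K j -> (forall k, K k -> r k <= r j) ->
      r j = \sum_L W L * [exists (j | j \in L), K j]%:R.
Proof.
have [N] := ubnP #|[set j | r j != 0]|.
elim: N r => // N IHN r; rewrite ltnS => leN r_ge0.
set P := [set j | r j != 0] in leN.
have [P0|[j0 j0P]] := set_0Vmem P.
  exists (fun=> 0) => // K j _ _.
  rewrite big1 => [|L _]; last by rewrite mul0r.
  by have /setP/(_ j) := P0; rewrite !inE => /negbFE/eqP.
have [jm jmP jm_min] : exists2 jm, jm \in P & {in P, forall j, r jm <= r j}.
  by case: (arg_minP r j0P) => jm; exists jm.
pose r' j := if j \in P then r j - r jm else 0.
have r'_ge0 j : 0 <= r' j.
  by rewrite /r'; case: ifP => // jP; rewrite subr_ge0 jm_min.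
have lt' : (#|[set j | r' j != 0%R]| < N)%N.
  apply: leq_trans leN; apply: proper_card; apply/properP; split.
    by apply/fintype.subsetP => j; rewrite inE /r'; case: ifP => //; rewrite eqxx.
  by exists jm => //; rewrite inE /r' jmP subrr eqxx.
have [W W_ge0 WE] := IHN r' lt' r'_ge0.
exists (fun L => W L + (if L == P then r jm else 0)).
  by move=> L; rewrite addr_ge0 //; case: ifP.
move=> K j Kj jmax.
under eq_bigr do rewrite mulrDl.
rewrite big_split /= [X in _ + X](bigD1 P) //= eqxx [X in _ + (_ + X)]big1; last first.
  by move=> L /negPf ->; rewrite mul0r.
have r'max k : K k -> r' k <= r' j.
  move=> Kk; rewrite /r'; case: ifP => [_|/negbT kP]; last exact: r'_ge0.
  case: ifP => [_|/negbT jP]; first by rewrite lerB ?jmax.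
  have rj0 : r j = 0 by move: jP; rewrite inE => /negbNE/eqP.
  by rewrite subr_le0 (le_trans (jmax k Kk)) // rj0.
rewrite addr0 -(WE K j) // /r'; case: ifP => [jP|/negbT jP].
  have -> : [exists (k | k \in P), K k] by apply/existsP; exists j; rewrite jP.
  by rewrite mulr1 subrK.
have rj0 : r j = 0 by move: jP; rewrite inE => /negbNE/eqP.
have -> : [exists (k | k \in P), K k] = false.
  apply/negbTE/existsP => -[k /andP[]]; rewrite inE => /eqP rk0 Kk.
  by apply: rk0; apply/eqP; rewrite eq_le r_ge0 andbT -rj0 jmax.
by rewrite rj0 mulr0 addr0.
Qed.

Local Open Scope classical_set_scope.
Local Open Scope ring_scope.

(** * Translating a union of intervals along a line *)

(** The convexity inequality on [[lo, hi]] for functions that may be infinite. *)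
Definition below_chord {R : realType} (F : R -> \bar R) (lo hi : R) :=
  forall a b : R, 0 <= a -> 0 <= b -> a + b = 1 ->
    (F (a * lo + b * hi)%R <= a%:E * F lo + b%:E * F hi)%E.

Section Intervals.
Context {R : realType}.
Implicit Types (k g d : R * R) (s : seq (R * R)) (u t : R).

(** Intervals are half-open so that splitting and merging them is exact;
a pair with [k.2 <= k.1] stands for the empty interval. *)
Definition ico u k := k.1 <= u < k.2.

(** A disjoint family is obtained by repeatedly replacing two overlapping
intervals by their hull.  Hulls, unlike differences, create no new left or
right endpoint, which is what keeps the critical positions down to those of
the theorem.  Disjointness is the statement that a point is counted at most
once. *)
Lemma merge_intervals s : exists2 s',
  (forall k, k \in s' -> k.1 \in unzip1 s /\ k.2 \in unzip2 s) &
  forall u, count (ico u) s' = has (ico u) s.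
Proof.
have [N] := ubnP (size s); elim: N s => // N IHN s; rewrite ltnS => sN.
have [[u]|/forallNP le1] := pselect (exists u, (1 < count (ico u) s)%N); last first.
  exists s => [k ks|u]; first by split; apply: map_f.
  by move: (le1 u); rewrite has_count; case: count => [|[|c]].
move=> c_gt1; have /hasP[k1 k1s uk1] : has (ico u) s.
  by rewrite has_count; apply: leq_trans c_gt1.
have Ps := perm_to_rem k1s; set s1 := rem k1 s in Ps.
have /hasP[k2 k2s uk2] : has (ico u) s1.
  by move: c_gt1; rewrite (permP Ps) /= uk1 has_count.
have Ps1 := perm_to_rem k2s; set s2 := rem k2 s1 in Ps1.
have {}Ps : perm_eq s [:: k1, k2 & s2].
  by rewrite (perm_trans Ps) // perm_cons.
(* [k1] and [k2] share the point [u], so their hull is their union. *)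
pose h := (Num.min k1.1 k2.1, Num.max k1.2 k2.2).
have [|s' s'E s'c] := IHN (h :: s2).
  by apply: leq_trans sN; rewrite (perm_size Ps).
exists s' => [k /s'E[k1E k2E]|w].
  rewrite (perm_mem (perm_map fst Ps)) (perm_mem (perm_map snd Ps)) /=.
  move: k1E k2E; rewrite !inE /= => k1E k2E; split.
    case/orP: k1E => [/eqP ->|->]; last by rewrite !orbT.
    by case: (leP k1.1 k2.1); rewrite eqxx ?orbT.
  case/orP: k2E => [/eqP ->|->]; last by rewrite !orbT.
  by case: (leP k1.2 k2.2); rewrite eqxx ?orbT.
rewrite s'c (perm_has _ Ps) /= orbA; congr (nat_of_bool (_ || _)).
move: uk1 uk2; rewrite /ico /h /= ge_min lt_max => /andP[? ?] /andP[? ?].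
apply/idP/idP; last by case/orP => /andP[-> ->]; rewrite ?orbT.
case/andP => /orP[a|a] /orP[b|b]; rewrite ?a ?b ?orbT //=.
  by case: (leP w u) => wu; lra.
by case: (leP w u) => wu; lra.
Qed.

(** Removing [k] from an interval leaves its part left of [k.1] and its part
right of [k.2]: a left end of a remaining piece comes from [d] or is the right
end of a removed interval, and symmetrically. *)
Lemma remove_intervals d s : {in s, forall k, k.1 <= k.2} -> exists2 g,
  (forall k, k \in g -> k.1 \in d.1 :: unzip2 s /\ k.2 \in d.2 :: unzip1 s) &
  forall u, count (ico u) g = ico u d && ~~ has (ico u) s.
Proof.
elim: s => [|k s IHs] s_le.
  exists [:: d] => [k|u]; last by rewrite /= andbT addn0.
  by rewrite inE => /eqP ->; rewrite !inE !eqxx.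
have k_le : k.1 <= k.2 by apply: s_le; rewrite inE eqxx.
have [|g gE gc] := IHs; first by move=> k' k's; apply: s_le; rewrite inE k's orbT.
exists ([seq (h.1, Num.min h.2 k.1) | h <- g] ++ [seq (Num.max h.1 k.2, h.2) | h <- g]).
  move=> h; rewrite mem_cat => /orP[] /mapP[h' /gE[h1 h2] ->] /=; split;
    move: h1 h2; rewrite !inE.
  - by case/orP => ->; rewrite ?orbT.
  - by case: leP => _ _; [case/orP => ->; rewrite ?orbT | rewrite eqxx orbT].
  - by case: leP => _ => [_|]; [rewrite eqxx orbT | case/orP => ->; rewrite ?orbT].
  - by move=> _; case/orP => ->; rewrite ?orbT.
move=> u; rewrite count_cat !count_map.
have -> : (ico u d && ~~ has (ico u) (k :: s) : nat) = (count (ico u) g * ~~ ico u k)%N.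
  by rewrite gc /= negb_or; case: (ico u d); case: (ico u k); case: (has _ _).
elim: g {gE gc} => [|h g IH] //=; rewrite mulnDl -{}IH.
rewrite addnACA; congr (_ + _)%N; rewrite /ico /= lt_min ge_max.
case: (ltP u k.1) => uk1; case: (leP k.2 u) => uk2;
  rewrite ?andbT ?andbF ?addn0 ?muln1 ?muln0 ?add0n //=.
by exfalso; lra.
Qed.

Definition itv_cap g k := (Num.max g.1 k.1, Num.min g.2 k.2).
Definition itv_shift t k := (k.1 + t, k.2 + t).

Lemma ico_cap u g k : ico u (itv_cap g k) = ico u g && ico u k.
Proof. by rewrite /ico /= ge_max lt_min andbACA. Qed.

Lemma count_cap u s1 s2 :
  count (ico u) [seq itv_cap g k | g <- s1, k <- s2] =
  (count (ico u) s1 * count (ico u) s2)%N.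
Proof.
elim: s1 => //= g s1 IH; rewrite count_cat IH mulnDl; congr (_ + _)%N.
rewrite count_map; under eq_count do rewrite /= ico_cap.
by case: (ico u g) => /=; rewrite ?mul1n // mul0n; elim: s2 {IH}.
Qed.

Definition len k := Num.max 0 (k.2 - k.1).

Lemma measurable_ico_has s : measurable [set u : R | has (ico u) s].
Proof.
have -> : [set u | has (ico u) s] = \big[setU/set0]_(k <- s) [set` `[k.1, k.2[ ].
  apply/seteqP; split=> u; rewrite -bigcup_seq /=.
    by case/hasP=> k ks uk; exists k => //=; rewrite in_itv.
  by case=> k /= ks; rewrite in_itv => uk; apply/hasP; exists k.
by apply: bigsetU_measurable => k _; exact: measurable_itv.
Qed.

Lemma measure_ico (A : set R) s : (forall u, count (ico u) s = `[< A u >]) ->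
  lebesgue_measure A = (\sum_(k <- s) len k)%:E.
Proof.
move=> cA.
have icoE u k : ico u k = (u \in `[k.1, k.2[) by rewrite in_itv.
have -> : lebesgue_measure A = (\int[lebesgue_measure]_u (\1_A u)%:E)%E.
  rewrite integral_indic ?setIT //.
  have -> : A = [set u | has (ico u) s].
    by apply/seteqP; split=> u /=; rewrite has_count cA lt0b => /asboolP.
  exact: measurable_ico_has.
transitivity (\int[lebesgue_measure]_u
    (\sum_(k <- s) (\1_([set` `[k.1, k.2[ ]) (u : R))%:E))%E.
  apply: eq_integral => u _; rewrite sumEFin; congr EFin.
  have -> : \1_A u = `[< A u >]%:R :> R.
    by rewrite indicE; congr (nat_of_bool _)%:R; apply/idP/asboolP; rewrite inE.
  rewrite -cA -sum1_count big_mkcond natr_sum; apply: eq_bigr => k _.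
  by rewrite indicE mem_setE -icoE; case: ifP.
rewrite ge0_integral_sum//; last first.
  move=> k; apply/measurable_EFinP; apply: measurable_indic.
  exact: measurable_itv.
rewrite -sumEFin; apply: eq_bigr => k _.
rewrite integral_indic; [|exact: measurableT|exact: measurable_itv].
rewrite setIT; apply: (eq_trans (lebesgue_measure_itv _)).
rewrite /= lte_fin /len.
by case: ltP => k12; [rewrite max_r ?EFinB //; lra | rewrite max_l //; lra].
Qed.

Definition covered d s : \bar R :=
  lebesgue_measure [set u | ico u d && has (ico u) s].

(** One-dimensional heart of the proof.  The total cover is a constant plus
the measure of the part of [d] outside [B] met by the translate of [A]; after
cutting both into disjoint intervals it is a sum of overlaps
[max 0 (min g.2 (k.2 + t) - max g.1 (k.1 + t))].  The maximum and the minimum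
inside bend the wrong way only when two left ends or two right ends meet, and
the endpoints of the pieces are such that the hypothesis excludes this
strictly between [lo] and [hi]; what remains is [max 0] of an affine function.
Meetings of a left end with a right end are harmless: there the overlap is
convex. *)
Lemma section_convex d (A B : seq (R * R)) (lo hi : R) :
  {in B, forall k, k.1 <= k.2} ->
  lo < hi ->
  (forall t, lo < t < hi -> {in A, forall k,
    [/\ k.1 + t != d.1, k.1 + t \notin unzip2 B,
        k.2 + t != d.2 & k.2 + t \notin unzip1 B]}) ->
  below_chord (fun t => covered d (B ++ [seq itv_shift t k | k <- A])) lo hi.
Proof.
move=> B_le lohi noev a b a0 b0 ab.
pose m t := covered d (B ++ [seq itv_shift t k | k <- A]).
have [G GE Gc] := remove_intervals d B_le.
have [A' A'E A'c] := merge_intervals A.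
have [B' _ B'c] := merge_intervals B.
pose c0 := \sum_(k <- [seq itv_cap g k | g <- [:: d], k <- B']) len k.
pose ov t := \sum_(g <- G) \sum_(k <- A') len (itv_cap g (itv_shift t k)).
have mE t : m t = (c0 + ov t)%:E.
  rewrite /m /covered (@measure_ico _ ([seq itv_cap g k | g <- [:: d], k <- B'] ++
     [seq itv_cap g k | g <- G, k <- [seq itv_shift t k | k <- A']])).
    congr EFin; rewrite big_cat /= /c0; congr (_ + _).
    by rewrite big_allpairs_dep; apply: eq_bigr => g _; rewrite big_map.
  move=> u; rewrite count_cat !count_cap Gc B'c /= addn0 count_map.
  rewrite has_cat has_map.
  rewrite (_ : count _ A' = has (preim (itv_shift t) (ico u)) A); last first.
    have icoS k : ico u (itv_shift t k) = ico (u - t) k.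
      by rewrite /ico /= lerBrDr ltrBlDr.
    by rewrite (eq_has (a2 := ico (u - t))) // -A'c; apply: eq_count => k /=; rewrite icoS.
  rewrite (_ : `[< _ >] = ico u d && (has (ico u) B ||
    has (preim (itv_shift t) (ico u)) A)); last by apply/asboolP/idP.
  by case: (ico u d); case: (has _ B); case: (has _ A).
rewrite -!/(m _) !mE -!EFinM -EFinD lee_fin.
have -> : a * (c0 + ov lo) + b * (c0 + ov hi) = c0 + (a * ov lo + b * ov hi).
  by rewrite -{3}[c0]mul1r -ab; ring.
rewrite lerD2l /ov !mulr_sumr -big_split /= big_seq [leRHS]big_seq.
apply: ler_sum => g /GE[g1 g2].
rewrite !mulr_sumr -big_split /= big_seq [leRHS]big_seq.
apply: ler_sum => k /A'E[k1 k2].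
(* A moving end never crossing a fixed one stays on one side of it. *)
have side (x y : R) : (forall t, lo < t < hi -> x + t != y) ->
    y <= x + lo \/ x + hi <= y.
  move=> nev; case: (leP y (x + lo)) => [|lt1]; first by left.
  case: (leP (x + hi) y) => [|lt2]; first by right.
  have /nev : lo < y - x < hi by apply/andP; split; lra.
  by rewrite subrKC eqxx.
have s1 : g.1 <= k.1 + lo \/ k.1 + hi <= g.1.
  apply: side => t /noev ev; case/mapP: k1 => k' k'A ->.
  have [e1 e2 _ _] := ev _ k'A.
  by move: g1; rewrite inE => /orP[/eqP ->|gB] //; apply: contraNneq e2 => ->.
have s2 : g.2 <= k.2 + lo \/ k.2 + hi <= g.2.
  apply: side => t /noev ev; case/mapP: k2 => k' k'A ->.
  have [_ _ e1 e2] := ev _ k'A.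
  by move: g2; rewrite inE => /orP[/eqP ->|gB] //; apply: contraNneq e2 => ->.
set t := a * lo + b * hi.
have lot : lo <= t by rewrite -[lo]mul1r -ab mulrDl lerD2l ler_wpM2l // ltW.
have thi : t <= hi by rewrite -[hi]mul1r -ab mulrDl lerD2r ler_wpM2l // ltW.
have [p pE] : exists p : bool, forall u, lo <= u <= hi ->
    Num.max g.1 (k.1 + u) = if p then g.1 else k.1 + u.
  case: s1 => s1; [exists false|exists true] => u /andP[? ?].
    by rewrite max_r //; lra.
  by rewrite max_l //; lra.
have [q qE] : exists q : bool, forall u, lo <= u <= hi ->
    Num.min g.2 (k.2 + u) = if q then g.2 else k.2 + u.
  case: s2 => s2; [exists true|exists false] => u /andP[? ?].
    by rewrite min_l //; lra.
  by rewrite min_r //; lra.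
rewrite /len /= !pE ?qE ?lexx ?lot ?(ltW lohi) //.
set x := (X in a * Num.max 0 X); set y := (X in b * Num.max 0 X).
rewrite [X in Num.max 0 X](_ : _ = a * x + b * y); last first.
  rewrite /x /y /t (_ : a = 1 - b); last by lra.
  by case: p {pE x y}; case: q {qE}; ring.
rewrite ge_max addr_ge0 ?mulr_ge0 ?le_max ?lexx //=.
by rewrite lerD // ler_wpM2l // le_max lexx orbT.
Qed.

End Intervals.

Section Covered.
Context {R : realType}.
Implicit Types (k d : R * R) (s : seq (R * R)).

Definition icc (u : R) k := k.1 <= u <= k.2.

(** Closed and half-open intervals differ by finitely many endpoints, a null
set. *)
Lemma covered_closed d s :
  lebesgue_measure [set u | icc u d && has (icc u) s] = covered d s.
Proof.
pose N := [set u | icc u d && has (icc u) s] `&` [set` unzip2 (d :: s)].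
have finN : finite_set N by apply: finite_setIr; exact: finite_seq.
have cN : countable N by exact: finite_set_countable.
have mN : measurable N by apply: countable_measurable.
rewrite /covered.
set A := [set u | ico u d && _].
have mA : measurable A.
  have -> : A = [set u | has (ico u) [:: d]] `&` [set u | has (ico u) s].
    by apply/seteqP; split=> u; rewrite /A /= orbF => /andP.
  by apply: measurableI; exact: measurable_ico_has.
transitivity (lebesgue_measure (A `|` N)); last first.
  by apply: measureU0 => //; exact: countable_lebesgue_measure0.
congr lebesgue_measure; apply/seteqP; split=> u /=; last first.
  case=> [|[]//] /andP[/andP[d1 d2]] /hasP[k ks /andP[k1 k2]].
  by rewrite /icc d1 (ltW d2) /=; apply/hasP; exists k; rewrite // k1 ltW.
move=> uc; have [uN|uN] := boolP (u \in unzip2 (d :: s)); first by right.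
left; move: uc uN; rewrite /A /= inE negb_or => /andP[/andP[d1 d2]].
move=> /hasP[k ks /andP[k1 k2]] /andP[ud us]; rewrite /ico d1 lt_neqAle ud d2 /=.
apply/hasP; exists k; rewrite // k1 lt_neqAle k2 andbT.
by apply: contraNneq us => ->; exact: map_f.
Qed.

Lemma eq_covered d s s' : (forall u, has (ico u) s = has (ico u) s') ->
  covered d s = covered d s'.
Proof.
by move=> ss'; congr lebesgue_measure; apply/seteqP; split=> u /=; rewrite ss'.
Qed.

End Covered.

(** * Area covered by a union of rectangles *)

Section Area.
Context {R : realType} {p : nat}.
Implicit Types (x y w h : 'I_p -> R) (L C : {set 'I_p}).

Definition coverage dx dw dy dl x w y h L : set (R * R) :=
  rectangle dx dy dw dl `&` \bigcup_(j in [set` L]) rectangle (x j) (y j) (w j) (h j).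

Definition area dx dw dy dl x w y h L : \bar R :=
  (@lebesgue_measure R \x @lebesgue_measure R)%E (coverage dx dw dy dl x w y h L).

Lemma rectangleE (a b c d : R) (q : R * R) :
  rectangle a b c d q <-> (a <= q.1 <= a + c) && (b <= q.2 <= b + d).
Proof. by rewrite /rectangle /= !in_itv /=; split => [[-> ->]|/andP]. Qed.

Lemma measurable_rectangle (a b c d : R) : measurable (rectangle a b c d).
Proof. by apply: measurableX; exact: measurable_itv. Qed.

Lemma measurable_coverage dx dw dy dl x w y h L :
  measurable (coverage dx dw dy dl x w y h L).
Proof.
apply: measurableI; first exact: measurable_rectangle.
apply: fin_bigcup_measurable => // *; exact: measurable_rectangle.
Qed.

(** The horizontal extents of the rectangles met by the line of ordinate [b];
none when that line misses the zone itself. *)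
Definition strip dy dl x w y h L b :=
  [seq (x j, x j + w j) | j <- enum L & (dy <= b <= dy + dl) && (y j <= b <= y j + h j)].

Lemma ysection_coverage dx dw dy dl x w y h L b :
  lebesgue_measure (ysection (coverage dx dw dy dl x w y h L) b) =
  covered (dx, dx + dw) (strip dy dl x w y h L b).
Proof.
rewrite -covered_closed; congr lebesgue_measure.
rewrite ysectionE; apply/seteqP; split=> u /=.
  case=> /rectangleE/= /andP[uD bD] [j /= jL /rectangleE/= /andP[uj bj]].
  rewrite /icc uD has_map; apply/hasP; exists j => //=.
  by rewrite mem_filter bD bj mem_enum.
rewrite has_map => /andP[uD] /hasP[j]; rewrite mem_filter mem_enum /=.
move=> /andP[/andP[bD bj] jL] uj; split; first by apply/rectangleE; rewrite /= bD andbT.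
by exists j => //; apply/rectangleE; rewrite /= bj andbT.
Qed.

Lemma area_integral dx dw dy dl x w y h L :
  area dx dw dy dl x w y h L =
  (\int[lebesgue_measure]_b covered (dx, (dx + dw)%R) (strip dy dl x w y h L b))%E.
Proof.
have mS := measurable_coverage dx dw dy dl x w y h L.
transitivity ((@lebesgue_measure R \x^ @lebesgue_measure R)%E
  (coverage dx dw dy dl x w y h L)).
  apply: product_measure_unique => // A B mA mB; exact: product_measure2E.
by apply: eq_integral => b _; exact: ysection_coverage.
Qed.

(** Both orders of integration compute the area, so that every statement
about moving abscissae also holds for ordinates. *)
Lemma area_swap dx dw dy dl x w y h L :
  area dx dw dy dl x w y h L = area dy dl dx dw y h x w L.
Proof.
rewrite [RHS]area_integral; apply: eq_integral => a _.
rewrite -ysection_coverage /=; congr lebesgue_measure.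
rewrite xsectionE ysectionE; apply/seteqP; split=> u /=;
  move=> [/rectangleE/= D [j jL /rectangleE/= rj]]; (split;
   [|exists j => //]); apply/rectangleE; rewrite /= andbC //.
Qed.

Lemma measurable_covered dx dw dy dl x w y h L :
  measurable_fun setT (fun b => covered (dx, dx + dw) (strip dy dl x w y h L b)).
Proof.
have := measurable_fun_ysection lebesgue_measure (measurable_coverage dx dw dy dl x w y h L).
by congr measurable_fun; apply/funext => b; rewrite /= ysection_coverage.
Qed.

Definition displace x C t j := if j \in C then x j + t else x j.

(** The one-dimensional inequality holds on every horizontal line with the
same excluded translations, hence survives integration. *)
Lemma area_convex dx dw dy dl x w y h L C lo hi :
  (forall j, 0 <= w j) -> lo < hi ->
  (forall t c, lo < t < hi -> c \in C ->
    [/\ x c + t != dx, x c + w c + t != dx + dw &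
      forall j, j \notin C -> x c + t != x j + w j /\ x c + w c + t != x j]) ->
  below_chord (fun t => area dx dw dy dl (displace x C t) w y h L) lo hi.
Proof.
move=> w0 lohi noev a b a0 b0 ab; rewrite !area_integral.
have cge0 d s : (0 <= covered d s)%E by exact: measure_ge0.
rewrite -!ge0_integralZl_EFin //; try exact: measurable_covered.
rewrite -ge0_integralD //; first last.
- by apply: measurable_funeM; exact: measurable_covered.
- by move=> v _; rewrite mule_ge0.
- by apply: measurable_funeM; exact: measurable_covered.
- by move=> v _; rewrite mule_ge0.
apply: ge0_le_integral => //.
- exact: measurable_covered.
- by apply: emeasurable_funD; apply: measurable_funeM; exact: measurable_covered.
move=> v _.
pose s := [seq j <- enum L | (dy <= v <= dy + dl) && (y j <= v <= y j + h j)].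
pose B := [seq (x j, x j + w j) | j <- s & j \notin C].
pose A := [seq (x j, x j + w j) | j <- s & j \in C].
have E t : covered (dx, dx + dw) (strip dy dl (displace x C t) w y h L v) =
    covered (dx, dx + dw) (B ++ [seq itv_shift t k | k <- A]).
  apply: eq_covered => u; rewrite /strip -/s /B /A -map_comp has_cat !has_map.
  apply/hasP/orP => [[j js uj]|[]/hasP[j]].
  - have [jC|jC] := boolP (j \in C); [right|left]; apply/hasP; exists j;
      rewrite 1?mem_filter ?jC //; move: uj; rewrite /= /displace ?jC ?(negbTE jC) //.
    by rewrite /itv_shift /= (addrAC _ t).
  - rewrite mem_filter => /andP[/negbTE jC js] uj.
    by exists j => //; rewrite /= /displace jC.
  - rewrite mem_filter => /andP[jC js] uj.
    by exists j => //; move: uj; rewrite /= /displace jC /itv_shift /= (addrAC _ t).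
rewrite !E.
apply: (@section_convex _ (dx, dx + dw) A B lo hi) => //.
  by move=> k /mapP[j _ ->] /=; rewrite lerDl.
move=> t tlh k /mapP[c]; rewrite mem_filter => /andP[cC _] -> /=.
have [e1 e2 e3] := noev _ _ tlh cC; split=> //; apply/mapP => -[_ /mapP[j +] ->];
  rewrite mem_filter => /andP[/e3[f1 f2] _] /eqP.
  by rewrite (negbTE f1).
by rewrite (negbTE f2).
Qed.

End Area.

(** * Moving to a critical position *)

Section Events.
Context {R : realType}.
Implicit Types (F : R -> \bar R) (E : seq R) (t : R).

Definition convex_between E F := forall lo hi : R,
  lo < hi -> {in E, forall e, ~~ (lo < e < hi)} -> below_chord F lo hi.

Lemma event_before E t lo0 : lo0 < t -> exists lo,
  [/\ lo < t, lo \in lo0 :: E & {in E, forall e, e < t -> e <= lo}].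
Proof.
move=> lo0t; elim: E => [|e E [lo [lot loE lomax]]].
  by exists lo0; rewrite inE eqxx.
case: (boolP (lo < e < t)) => [/andP[loe et]|Ne].
  exists e; split => //; first by rewrite !inE eqxx orbT.
  move=> e'; rewrite inE => /orP[/eqP -> //|/lomax e'lo /e'lo e'lelo].
  by rewrite (le_trans e'lelo) // ltW.
exists lo; split => //; first by move: loE; rewrite !inE => /orP[] ->; rewrite ?orbT.
move=> e'; rewrite inE => /orP[/eqP -> et|/lomax//].
by move: Ne; rewrite et andbT -leNgt.
Qed.

Lemma event_after E t hi0 : t < hi0 -> exists hi,
  [/\ t < hi, hi \in hi0 :: E & {in E, forall e, t < e -> hi <= e}].
Proof.
rewrite -ltrN2 => /(event_before [seq - e | e <- E])[lo [lot loE lomax]].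
exists (- lo); split; first by rewrite -ltrN2 opprK.
  move: loE; rewrite !inE => /orP[/eqP ->|/mapP[e eE ->]]; rewrite opprK ?eqxx //.
  by rewrite eE orbT.
move=> e eE te; rewrite lerNl; apply: lomax; last by rewrite ltrN2.
exact: map_f.
Qed.

(** Between consecutive events convexity bounds [F t] by its value at one of
the two.  Beyond the last event on either side, a point where [F] is minimal
plays the part of the missing event: a bound by its value is a bound by the
value at any event. *)
Lemma event_le E F e0 : e0 \in E -> (forall t, 0 <= F t)%E -> convex_between E F ->
  (forall t, exists2 lo, lo < t & forall t', (F lo <= F t')%E) ->
  (forall t, exists2 hi, t < hi & forall t', (F hi <= F t')%E) ->
  forall t, exists2 e, e \in E & (F t <= F e)%E.
Proof.
move=> e0E F0 Fconv lomin himin t.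
have [tE|tE] := boolP (t \in E); first by exists t.
have [lo0 /(event_before E)[lo [lot loE lomax]] lo0min] := lomin t.
have [hi0 /(event_after E)[hi [thi hiE hil]] hi0min] := himin t.
have bound s s0 : s \in s0 :: E -> (forall t', (F s0 <= F t')%E) -> (F t <= F s)%E ->
    exists2 e, e \in E & (F t <= F e)%E.
  rewrite inE => /orP[/eqP -> s0min ts0|sE _ ts]; last by exists s.
  by exists e0; rewrite // (le_trans ts0).
pose b := (t - lo) / (hi - lo).
have hilo : 0 < hi - lo by lra.
have b0 : 0 <= b by apply: divr_ge0; lra.
have b1 : b <= 1 by rewrite ler_pdivrMr //; lra.
have tab : t = (1 - b) * lo + b * hi by rewrite /b; field; rewrite gt_eqF.
have a0 : 0 <= 1 - b by lra.
have : (F t <= (1 - b)%:E * F lo + b%:E * F hi)%E.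
  rewrite {1}tab; apply: Fconv => //; [lra| |lra].
  move=> e eE; apply/negP => /andP[loe ehi]; have [et|te|ett] := ltgtP e t.
  - by have := lomax _ eE et; rewrite leNgt loe.
  - by have := hil _ eE te; rewrite leNgt ehi.
  - by rewrite ett (negbTE tE) in eE.
have ab1 z : (0 <= z -> (1 - b)%:E * z + b%:E * z = z)%E.
  by move=> z0; rewrite -ge0_muleDl ?lee_fin // -EFinD subrK mul1e.
have [lohi|hilo'] := leP (F lo) (F hi) => Ft.
  apply: (bound _ _ hiE hi0min); rewrite (le_trans Ft) // -{2}(ab1 _ (F0 hi)).
  by rewrite leeD2r // lee_wpmul2l ?lee_fin.
apply: (bound _ _ loE lo0min); rewrite (le_trans Ft) // -{2}(ab1 _ (F0 lo)).
by rewrite leeD2l // lee_wpmul2l ?lee_fin // ltW.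
Qed.

Lemma fin_lbound (T : finType) (f : T -> R) : exists M, forall i, M <= f i.
Proof.
exists (- \sum_i `|f i|) => i; rewrite lerNl (le_trans (ler_norm _)) // normrN.
by rewrite (bigD1 i) //= lerDl sumr_ge0.
Qed.
End Events.

Section Improvement.
Context {R : realType} {n p : nat}.
Variables (dx dw dy dl : 'I_n -> R) (w y h : 'I_p -> R) (W : 'I_n -> {set 'I_p} -> R).
Hypotheses (n_gt0 : (0 < n)%N) (w_ge0 : forall j, 0 <= w j) (W_ge0 : forall i L, 0 <= W i L).
Implicit Types (x : 'I_p -> R) (l : seq 'I_p) (C : {set 'I_p}).

Definition reward x : \bar R :=
  (\sum_i \sum_L (W i L)%:E * area (dx i) (dw i) (dy i) (dl i) x w y h L)%E.

Definition touches x c := exists i, x c = dx i \/ x c = dx i + dw i - w c.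

Definition abuts x c j := x c = x j - w c \/ x c = x j + w j.

(** The list is in reverse order: each index is placed relative to a zone or
to an index further down the list. *)
Fixpoint anchored x l : Prop :=
  if l is c :: l' then
    (touches x c \/ exists2 j, j \in l' & abuts x c j) /\ anchored x l'
  else True.

Lemma eq_anchored x x' l : {in l, x =1 x'} -> anchored x l -> anchored x' l.
Proof.
elim: l => //= c l IH xx' [xc xl].
have xx'l : {in l, x =1 x'} by move=> j jl; apply: xx'; rewrite inE jl orbT.
have xx'c : x c = x' c by apply: xx'; rewrite inE eqxx.
split; last exact: IH.
rewrite /touches /abuts -xx'c; case: xc => [|[j jl xcj]]; [by left|right].
by exists j => //; rewrite -(xx'l _ jl).
Qed.

Let area_ge0 x i L : (0 <= area (dx i) (dw i) (dy i) (dl i) x w y h L)%E.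
Proof. exact: measure_ge0. Qed.

Lemma reward_ge0 x : (0 <= reward x)%E.
Proof.
by apply: sume_ge0 => i _; apply: sume_ge0 => L _; rewrite mule_ge0 ?lee_fin.
Qed.

(** The translations of the indices outside [l] that make one of them critical
with respect to a zone or to an index in [l]. *)
Definition events x l : seq R :=
  [seq e | c <- enum [set j | j \notin l]%SET, e <-
     [seq dx i - x c | i <- enum 'I_n] ++
     [seq dx i + dw i - w c - x c | i <- enum 'I_n] ++
     [seq x j + w j - x c | j <- l] ++ [seq x j - w c - x c | j <- l]].

Lemma eventsP x l e : e \in events x l -> exists2 c, c \notin l &
  let x' := displace x [set j | j \notin l]%SET e in
  touches x' c \/ exists2 j, j \in l & abuts x' c j.
Proof.
case/allpairsPdep => c [e' [+ eE ->]]; rewrite mem_enum inE => cl.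
exists c => //=.
have shc t : displace x [set j | j \notin l]%SET t c = x c + t by rewrite /displace inE cl.
have shl j t : j \in l -> displace x [set j | j \notin l]%SET t j = x j.
  by move=> jl; rewrite /displace inE jl.
move: eE; rewrite !mem_cat => /or4P[] /mapP[j jl ->].
- by left; exists j; left; rewrite shc; ring.
- by left; exists j; right; rewrite shc; ring.
- by right; exists j => //; right; rewrite shc shl //; ring.
- by right; exists j => //; left; rewrite shc shl //; ring.
Qed.

Lemma mem_events x l c e : c \notin l ->
  [\/ exists i, x c + e = dx i, exists i, x c + w c + e = dx i + dw i,
      exists2 j, j \in l & x c + e = x j + w j |
      exists2 j, j \in l & x c + w c + e = x j] -> e \in events x l.
Proof.
move=> cl ev; apply/allpairsPdep; exists c, e; rewrite mem_enum inE; split=> //.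
rewrite !mem_cat; apply/or4P; case: ev => [[i ev]|[i ev]|[j jl ev]|[j jl ev]].
- by constructor 1; apply/mapP; exists i; rewrite ?mem_enum //; lra.
- by constructor 2; apply/mapP; exists i; rewrite ?mem_enum //; lra.
- by constructor 3; apply/mapP; exists j => //; lra.
- by constructor 4; apply/mapP; exists j => //; lra.
Qed.

Lemma reward_convex x l : convex_between (events x l)
  (fun t => reward (displace x [set j | j \notin l]%SET t)).
Proof.
move=> lo hi lohi noev a b a0 b0 ab; rewrite /reward.
rewrite !ge0_sume_distrr; try by move=> i _; apply: sume_ge0 => L _; rewrite mule_ge0 ?lee_fin.
rewrite -big_split; apply: lee_sum => i _.
rewrite /= !ge0_sume_distrr; try by move=> L _; rewrite mule_ge0 ?lee_fin.
rewrite -big_split; apply: lee_sum => L _.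
rewrite /= muleCA [X in (_ + X)%E]muleCA -ge0_muleDr ?mule_ge0 ?lee_fin //.
apply: lee_wpmul2l; first by rewrite lee_fin.
suff chord : below_chord (fun t => area (dx i) (dw i) (dy i) (dl i)
    (displace x [set j | j \notin l]%SET t) w y h L) lo hi by exact: chord.
apply: area_convex => // t c tlh.
rewrite inE => cl.
have nev : ~~ (t \in events x l) by apply/negP => /noev; rewrite tlh.
have nevP := fun ev => negP nev (mem_events cl ev).
split; [apply/eqP => e..|]; [apply: nevP..|move=> j]; last first.
- rewrite inE negbK => jl; split; apply/eqP => e; apply: nevP.
    by constructor 3; exists j.
  by constructor 4; exists j.
- by constructor 2; exists i.
- by constructor 1; exists i.
Qed.

(** A group lying beside all the zones earns nothing, so only the rectangles
at rest count. *)
Lemma reward_far x l t :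
  (forall c i, c \notin l -> x c + w c + t < dx i \/ dx i + dw i < x c + t) ->
  forall t', (reward (displace x [set j | j \notin l]%SET t) <=
              reward (displace x [set j | j \notin l]%SET t'))%E.
Proof.
move=> away t'; apply: lee_sum => i _; apply: lee_sum => L _.
apply: lee_wpmul2l; first by rewrite lee_fin.
apply: le_measure.
- by rewrite inE; exact: measurable_coverage.
- by rewrite inE; exact: measurable_coverage.
move=> q [Dq [j jL Sq]]; split=> //; exists j => //.
move: Dq Sq => /rectangleE/andP[/andP[D1 D2] _].
rewrite /displace inE; case: ifP => // jl /rectangleE/andP[/andP[S1 S2] _].
by exfalso; case: (away j i jl); lra.
Qed.

(** Translating all the indices outside [l] together preserves their mutual
positions, so that only contacts with [l] and with the zones matter; one of
these contacts is reached without losing reward. *)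
Lemma anchor_one x l : (exists c, c \notin l) -> anchored x l ->
  exists x' c, [/\ c \notin l, anchored x' (c :: l) & (reward x <= reward x')%E].
Proof.
move=> [c0 c0l] xl; pose C := [set j | j \notin l]%SET.
have shift0 : displace x C 0 = x by apply/funext => j; rewrite /displace addr0; case: ifP.
pose i0 := Ordinal n_gt0.
have e0E : dx i0 - x c0 \in events x l.
  by apply: (mem_events c0l); constructor 1; exists i0; ring.
have lomin t : exists2 lo, lo < t & forall t',
    (reward (displace x C lo) <= reward (displace x C t'))%E.
  have [M leM] := fin_lbound (fun ci : 'I_p * 'I_n => dx ci.2 - x ci.1 - w ci.1).
  exists (Num.min M t - 1); first by rewrite ltrBlDr gt_min ltrDl ltr01 orbT.
  apply: reward_far => c i _; left; have := leM (c, i) => /=.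
  have : Num.min M t <= M by rewrite ge_min lexx.
  by lra.
have himin t : exists2 hi, t < hi & forall t',
    (reward (displace x C hi) <= reward (displace x C t'))%E.
  have [M leM] := fin_lbound (fun ci : 'I_p * 'I_n => x ci.1 - dx ci.2 - dw ci.2).
  exists (Num.max (- M) t + 1).
    by rewrite (le_lt_trans (_ : _ <= Num.max (- M) t)) ?ltrDl // le_max lexx orbT.
  apply: reward_far => c i _; right; have := leM (c, i) => /=.
  have : - M <= Num.max (- M) t by rewrite le_max lexx.
  by lra.
have [e /eventsP[c cl /= xc] xe] := event_le e0E (fun t => reward_ge0 _)
  (@reward_convex x l) lomin himin 0.
rewrite shift0 in xe; exists (displace x C e), c; split; [exact: cl| |exact: xe].
split; first exact: xc.
apply: eq_anchored xl => j jl.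
by rewrite /displace inE jl.
Qed.

Lemma anchor_all x : exists x' l, [/\ uniq l, size l = p, anchored x' l &
  (reward x <= reward x')%E].
Proof.
suff H k : (k <= p)%N -> exists x' l, [/\ uniq l, size l = k, anchored x' l &
  (reward x <= reward x')%E] by exact: H.
elim: k => [_|k IH kp]; first by exists x, [::].
have [x' [l [l_uniq l_size x'l xx']]] := IH (ltnW kp).
have [|x'' [c [cl x''l x'x'']]] := anchor_one _ x'l.
  apply/existsP; rewrite -negb_forall; apply: contraL kp => /forallP lT.
  rewrite -leqNgt -l_size -[leqLHS]card_ord; apply: leq_trans (card_size l).
  by apply: subset_leq_card; apply/fintype.subsetP => j _; exact: lT.
exists x'', (c :: l); split; [by rewrite /= cl|by rewrite /= l_size|exact: x''l|].
exact: le_trans xx' x'x''.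
Qed.

End Improvement.

(** * The objective as a combination of areas *)

Section Objective.
Context {R : realType} {n p : nat} (I : pmclp R n p).

Definition width (z : 'I_p -> R) j := z j * w0 I.
Definition height (z : 'I_p -> R) j := z j * l0 I.

Lemma rate_anti i (z z' : R) : Xi I z -> Xi I z' -> z <= z' -> rate I i z' <= rate I i z.
Proof.
move=> Xz Xz'; rewrite le_eqVlt => /orP[/eqP -> //|zz'].
apply: ler_wpM2l; first exact: v_ge0.
rewrite lef_pV2 ?posrE ?eta_gt0 //; apply: ltW; apply: eta_incr zz';
  by rewrite in_itv /= andbT; exact: (@Xi_ge1 _ _ _ I).
Qed.

Lemma best_qos_attained (s : solution R p) q j :
  service_zone I s j q -> exists j0, [/\ service_zone I s j0 q, zs s j0 = best_qos I s q &
    forall k, service_zone I s k q -> zs s j0 <= zs s k].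
Proof.
move=> jq; have /asboolP jq' := jq.
have [j0 /asboolP j0q j0min] := @arg_minP _ _ _ j
  (fun j => `[< service_zone I s j q >]) (zs s) jq'.
have zmin k : service_zone I s k q -> zs s j0 <= zs s k.
  by move=> kq; apply: j0min; apply/asboolP.
exists j0; split=> //; apply/eqP; rewrite eq_le; apply/andP; split.
  by apply: lb_le_inf; [exists (zs s j0); exists j0|move=> _ [k kq <-]; exact: zmin].
by apply: ge_inf; [exists (zs s j0) => _ [k kq <-]; exact: zmin|exists j0].
Qed.

(** Rates decrease with the scaling factor, so the rate at the best quality
of service is the largest rate among the service zones covering a point.
Splitting this maximum into layers turns the captured reward into a
nonnegative combination of areas, with weights that ignore the positions. *)
Lemma captured_layers (z : 'I_p -> R) i : (forall j, Xi I (z j)) ->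
  exists2 W : {set 'I_p} -> R, (forall L, 0 <= W L) &
    forall x y : 'I_p -> R, captured I (Solution x y z) i =
      (\sum_L (W L)%:E *
        area (xd I i) (wd I i) (yd I i) (ld I i) x (width z) y (height z) L)%E.
Proof.
move=> Xz; have [|W W_ge0 WE] := @max_layers R _ (fun j => rate I i (z j)).
  by move=> j; rewrite divr_ge0 ?v_ge0 // ltW // eta_gt0.
exists W => // x y; set s := Solution x y z.
pose S L := coverage (xd I i) (wd I i) (yd I i) (ld I i) x (width z) y (height z) L.
have mS L : measurable (S L) by exact: measurable_coverage.
transitivity (\int[(@lebesgue_measure R \x @lebesgue_measure R)%E]_q
    (\sum_L (W L)%:E * (\1_(S L) q)%:E))%E; last first.
  have m1S L : measurable_fun setT (fun q => (\1_(S L) q)%:E : \bar R).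
    by apply/measurable_EFinP; exact: measurable_indic.
  rewrite ge0_integral_sum //; last 2 first.
  - by move=> L; apply: measurable_funeM; exact: m1S.
  - by move=> L q _; rewrite mule_ge0 ?lee_fin.
  apply: eq_bigr => L _; rewrite ge0_integralZl_EFin //; last exact: m1S.
  congr (_ * _)%E.
  by rewrite integral_indic; [rewrite setIT|exact: measurableT|exact: mS].
rewrite /captured integral_mkcond; apply: eq_integral => q _.
under eq_bigr do rewrite -EFinM.
rewrite sumEFin patchE.
have indicS L : \1_(S L) q = (`[< demand_zone I i q >] &&
    [exists (j | j \in L), `[< service_zone I s j q >]])%:R :> R.
  rewrite indicE; congr (nat_of_bool _)%:R; apply/idP/andP.
    rewrite inE => -[Dq [j jL jq]]; split; first exact/asboolP.
    by apply/existsP; exists j; rewrite jL; apply/asboolP.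
  case=> /asboolP Dq /existsP[j /andP[jL /asboolP jq]].
  by rewrite inE; split=> //; exists j.
under eq_bigr do rewrite indicS.
case: ifPn => [|nq].
  rewrite inE => -[Dq [j0 _ /best_qos_attained[j [jq zj jmin]]]].
  congr EFin; rewrite (asboolT Dq) /= -zj.
  apply: (WE (fun k => `[< service_zone I s k q >]) j); first exact/asboolP.
  move=> k /asboolP kq; apply: rate_anti; [exact: Xz|exact: Xz|exact: jmin].
rewrite big1 // => L _; case: asboolP => Dq /=; last by rewrite mulr0.
case: existsP => [[j /andP[_ /asboolP jq]]|_]; last by rewrite mulr0.
by case/negP: nq; rewrite inE; split=> //; exists j.
Qed.

Lemma objective_reward (z : 'I_p -> R) : (forall j, Xi I (z j)) ->
  exists2 W : 'I_n -> {set 'I_p} -> R, (forall i L, 0 <= W i L) &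
    forall x y : 'I_p -> R,
      objective I (Solution x y z) =
        reward (xd I) (wd I) (yd I) (ld I) (width z) y (height z) W x /\
      objective I (Solution x y z) =
        reward (yd I) (ld I) (xd I) (wd I) (height z) x (width z) W y.
Proof.
move=> Xz; have ex i := captured_layers i Xz.
pose W i := sval (cid2 (ex i)).
have W_ge0 i L : 0 <= W i L by exact: (svalP (cid2 (ex i))).1.
exists W => // x y.
have E : objective I (Solution x y z) =
    reward (xd I) (wd I) (yd I) (ld I) (width z) y (height z) W x.
  by apply: eq_bigr => i _; have := s2valP' (cid2 (ex i)).
split; first exact: E.
rewrite E; apply: eq_bigr => i _; apply: eq_bigr => L _.
by rewrite area_swap.
Qed.
End Objective.

(** * Critical sequences *)

Section Grid.
Context {R : realType} {n p : nat}.
Variables (dx dw : 'I_n -> R) (w : 'I_p -> R).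
Implicit Types (x : 'I_p -> R) (l : seq 'I_p) (us : seq R).

(** All the positions reachable along an anchored list with [k + 1] indices,
the widths being taken in [us]. *)
Fixpoint grid us k : seq R :=
  if k is k'.+1 then
    grid us k' ++ [seq v - u | v <- grid us k', u <- us] ++
                  [seq v + u | v <- grid us k', u <- us]
  else [seq dx i | i <- enum 'I_n] ++ [seq dx i + dw i - u | i <- enum 'I_n, u <- us].

Lemma anchored_grid us x l : (forall j, w j \in us) -> anchored dx dw w x l ->
  {in l, forall j, x j \in grid us (size l)}.
Proof.
move=> wus; elim: l => //= c l IH [xc /IH xl] j; rewrite inE !mem_cat.
case/orP => [/eqP ->|/xl -> //]; case: xc => [[i xc]|[k /xl kl [] ->]].
- have x0 : x c \in grid us 0.
    rewrite mem_cat; case: xc => ->; apply/orP; [left|right].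
      by apply: map_f; rewrite mem_enum.
    by apply/allpairsP; exists (i, w c); rewrite mem_enum wus.
  suff -> : x c \in grid us (size l) by [].
  by elim: (size l) => // m /= xm; rewrite mem_cat xm.
- by apply/or3P; constructor 2; apply/allpairsP; exists (x k, w c); rewrite kl wus.
- by apply/or3P; constructor 3; apply/allpairsP; exists (x k, w k); rewrite kl wus.
Qed.

Lemma anchored_nth j0 x l k : anchored dx dw w x l -> (k < size l)%N ->
  let c := nth j0 (rev l) k in
  touches dx dw w x c \/ exists2 j, j \in take k (rev l) & abuts w x c j.
Proof.
elim: l => //= c l IH [xc xl]; rewrite ltnS => kl.
rewrite rev_cons nth_rcons -cats1 take_cat size_rev.
have [|lk] := ltnP k (size l); first exact: IH.
have {kl lk} -> : k = size l by apply/eqP; rewrite eqn_leq kl.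
rewrite eqxx subnn take0 cats0.
by case: xc => [|[j jl xcj]]; [left|right; exists j; rewrite ?mem_rev].
Qed.

Lemma anchored_critical x l (ID : set R) (OS : set 'I_p -> set R) :
  uniq l -> size l = p -> anchored dx dw w x l ->
  (forall j, touches dx dw w x j -> ID (x j)) ->
  (forall j k (J : set 'I_p), J k -> abuts w x j k -> OS J (x j)) ->
  critical_sequence ID OS x.
Proof.
move=> l_uniq l_size xl tID aOS.
have [p0|p_gt0] := posnP p.
  by exists id; split=> // k; have := ltn_ord k; rewrite {2}p0.
pose j0 := Ordinal p_gt0; exists (fun k => nth j0 (rev l) k); split.
  move=> k k' /eqP; rewrite nth_uniq ?size_rev ?l_size ?rev_uniq // => /eqP.
  exact: val_inj.
move=> k; have kl : (k < size l)%N by rewrite l_size.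
have := anchored_nth j0 xl kl; split=> [k0|_].
  by case: H => [/tID //|[j]]; rewrite k0 take0.
case: H => [/tID|[j jk]]; first by left.
move=> xj; right; apply: (aOS _ _ _ _ xj).
case/(nthP j0): jk => m; rewrite size_takel ?size_rev ?l_size ?(ltnW (ltn_ord k)) // => mk.
rewrite nth_take // => <-; exists (Ordinal (ltn_trans mk (ltn_ord k))) => //.
Qed.
End Grid.

(** The indices preceding [t k] differ from it, since [t] is injective, and
[t] reaches every index, since ['I_p] is finite. *)
Lemma critical_sequence_all (R : realType) p (ID : set R) (OS : set 'I_p -> set R) c :
  (0 < p)%N -> (forall J J', J `<=` J' -> OS J `<=` OS J') ->
  critical_sequence ID OS c -> all_critical ID OS c.
Proof.
move=> p_gt0 OS_mono [t [t_inj tc]]; split=> [j|]; last first.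
  by exists (t (Ordinal p_gt0)); apply: (tc _).1.
have [t' _ tK] := injF_bij t_inj; rewrite -(tK j); set k := t' j.
have [c0 ck] := tc k; have [/c0|/ck] := posnP k; first by left.
case=> [|OSk]; [by left|right]; apply: OS_mono OSk => _ [m /= mk <-] /t_inj mk'.
by move: mk; rewrite mk' ltnn.
Qed.

Lemma seq_code (R : realType) p (g : seq R) (x : 'I_p -> R) : (forall j, x j \in g) ->
  exists f : {ffun 'I_p -> 'I_(size g)}, x = fun j => nth 0 g (f j).
Proof.
move=> xg; have ig j : (index (x j) g < size g)%N by rewrite index_mem.
by exists [ffun j => Ordinal (ig j)]; apply/funext => j; rewrite ffunE nth_index.
Qed.

(** * Optimal solutions *)

Section Optimum.
Context {R : realType} {n p : nat} (I : pmclp R n p).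
Hypothesis n_gt0 : (0 < n)%N.
Implicit Types s : solution R p.

Definition anchored_solution s :=
  (exists l, [/\ uniq l, size l = p & anchored (xd I) (wd I) (width I (zs s)) (xs s) l]) /\
  (exists l, [/\ uniq l, size l = p & anchored (yd I) (ld I) (height I (zs s)) (ys s) l]).

(** Abscissae are moved first, ordinates next: anchoring one family of
coordinates does not affect the other. *)
Lemma anchor_solution s : feasible I s -> exists s',
  [/\ feasible I s', anchored_solution s' & (objective I s <= objective I s')%E].
Proof.
case: s => x y z Xz; have [W W_ge0 E] := objective_reward Xz.
have z_ge0 j : 0 <= z j by rewrite (le_trans ler01) // (Xi_ge1 (Xz j)).
have w_ge0 j : 0 <= width I z j by rewrite mulr_ge0 ?w0_ge0.
have h_ge0 j : 0 <= height I z j by rewrite mulr_ge0 ?l0_ge0.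
have [x' [lx [ux sx ax]]] := anchor_all (xd I) (wd I) (yd I) (ld I) y (height I z)
  n_gt0 w_ge0 W_ge0 x.
rewrite -(E x y).1 -(E x' y).1 => xx'.
have [y' [ly [uy sy ay]]] := anchor_all (yd I) (ld I) (xd I) (wd I) x' (width I z)
  n_gt0 h_ge0 W_ge0 y.
rewrite -(E x' y).2 -(E x' y').2 => yy'.
exists (Solution x' y' z); split; [exact: Xz| |exact: le_trans xx' yy'].
by split; [exists lx|exists ly].
Qed.

(** Anchored feasible solutions have coordinates in finite grids, so one of
them is best among them; every feasible solution being dominated by an
anchored one, it is optimal.  No continuity or compactness is involved. *)
Lemma exists_optimal_anchored : exists2 s, optimal I s & anchored_solution s.
Proof.
have /finite_seqP[zl zlE] := Xi_finite I.
have inXi z : Xi I z -> z \in zl by rewrite zlE.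
pose gx := grid (xd I) (wd I) [seq z * w0 I | z <- zl] p.
pose gy := grid (yd I) (ld I) [seq z * l0 I | z <- zl] p.
pose code (f : {ffun 'I_p -> 'I_(size gx)} * {ffun 'I_p -> 'I_(size gy)} *
               {ffun 'I_p -> 'I_(size zl)}) :=
  Solution (fun j => nth 0 gx (f.1.1 j)) (fun j => nth 0 gy (f.1.2 j))
           (fun j => nth 0 zl (f.2 j)).
have codeP s : feasible I s -> anchored_solution s -> exists f, s = code f.
  case: s => x y z Xz [[lx /= [ux sx ax]] [ly /= [uy sy ay]]].
  have full l : uniq l -> size l = p -> forall j : 'I_p, j \in l.
    move=> ul sl j; have sub : {subset l <= enum 'I_p} by move=> k _; rewrite mem_enum.
    have [|_ ->] := uniq_min_size ul sub; last by rewrite mem_enum.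
    by rewrite size_enum_ord sl.
  have [|fx ->] := @seq_code _ _ gx x.
    move=> j; rewrite /gx -[X in grid _ _ _ X]sx.
    apply: anchored_grid ax _ _; last exact: full.
    by move=> k; apply: map_f; exact/inXi/Xz.
  have [|fy ->] := @seq_code _ _ gy y.
    move=> j; rewrite /gy -[X in grid _ _ _ X]sy.
    apply: anchored_grid ay _ _; last exact: full.
    by move=> k; apply: map_f; exact/inXi/Xz.
  have [|fz ->] := @seq_code _ _ zl z; first by move=> j; exact/inXi/Xz.
  by exists (fx, fy, fz).
pose P f := `[< feasible I (code f) /\ anchored_solution (code f) >].
have [z0 Xz0] := Xi_neq0 I.
have [|s0 [Xs0 as0 _]] := @anchor_solution (Solution (fun=> 0) (fun=> 0) (fun=> z0)).
  by move=> j.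
have [f0 s0E] := codeP _ Xs0 as0.
have Pf0 : P f0 by apply/asboolP; rewrite -s0E.
have [f /asboolP[Xf af] fmax] := @arg_maxP _ _ _ f0 P (objective I \o code) Pf0.
exists (code f) => //; split=> // s /anchor_solution[s' [Xs' as' ss']].
have [f' s'E] := codeP _ Xs' as'; rewrite (le_trans ss') // s'E.
by apply: fmax; apply/asboolP; rewrite -s'E.
Qed.
End Optimum.

Theorem theorem2 (R : realType) (n p : nat) (I : pmclp R n p)
    (n_gt0 : (0 < n)%N) (p_gt0 : (0 < p)%N) :
  exists s : solution R p,
    [/\ optimal I s,
        critical_sequence (X_ID I) (X_OS I s) (xs s),
        critical_sequence (Y_ID I) (Y_OS I s) (ys s),
        all_critical (X_ID I) (X_OS I s) (xs s) &
        all_critical (Y_ID I) (Y_OS I s) (ys s)].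
Proof.
have [s opt [[lx [ux sx ax]] [ly [uy sy ay]]]] := exists_optimal_anchored I n_gt0.
have Xz := opt.1.
have cx : critical_sequence (X_ID I) (X_OS I s) (xs s).
  apply: anchored_critical ux sx ax _ _ => [j [i xj]|j k J Jk xjk].
    by exists (zs s j) => //; exists i => //=; rewrite mulrC.
  by exists (zs s j) => //; exists k => //=; rewrite 2!(mulrC (w0 I)).
have cy : critical_sequence (Y_ID I) (Y_OS I s) (ys s).
  apply: anchored_critical uy sy ay _ _ => [j [i yj]|j k J Jk yjk].
    by exists (zs s j) => //; exists i => //=; rewrite mulrC.
  by exists (zs s j) => //; exists k => //=; rewrite 2!(mulrC (l0 I)).
exists s; split=> //; apply: critical_sequence_all => // J J' JJ' v [z Xiz [j Jj vj]];
  by exists z => //; exists j => //; exact: JJ'.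
Qed.
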